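(* For $4\leq n\leq 7$ there is no simple graph $G$ on $n$ vertices such that $G$ and its complement $\overline{G}$ are both connected and $rc(G)=rc(\overline{G})=2$.
   Context: All graphs are simple, finite and undirected. For a connected graph $G$, an edge coloring $c:E(G)\to\{1,\dots,k\}$ (adjacent edges may receive the same color) makes $G$ rainbow connected if for every two vertices $u,v$ there is a $u$–$v$ path whose edges have pairwise distinct colors; $rc(G)$ is the minimum such $k$. $\overline{G}$ denotes the complement of $G$. *)

(* Defs.v *)
From mathcomp Require Import all_boot.

Set Implicit Arguments.
Unset Strict Implicit.
Unset Printing Implicit Defensive.

Record sgraph (T : finType) := SGraph {
  adj :> rel T;
  adj_sym : symmetric adj;
  adj_irrefl : irreflexive adj
}.

Section Graphs.
Variable T : finType.
Implicit Types G : sgraph T.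

Definition compl_adj G : rel T := fun x y => (x != y) && ~~ G x y.

Lemma compl_adj_sym G : symmetric (compl_adj G).
Proof. by move=> x y; rewrite /compl_adj eq_sym adj_sym. Qed.

Lemma compl_adj_irrefl G : irreflexive (compl_adj G).
Proof. by move=> x; rewrite /compl_adj eqxx. Qed.

Definition compl G : sgraph T :=
  SGraph (@compl_adj_sym G) (@compl_adj_irrefl G).

Definition graph_connected G : Prop := forall x y : T, connect G x y.

Definition edges G : {set {set T}} :=
  [set [set p.1; p.2] | p in [set p : T * T | G p.1 p.2]].

(* A colouring E(G) -> {1, ..., k} is a function on all vertex subsets whose
   values are constrained, and used, only on the edges of G. *)
Definition edge_coloring G (k : nat) (c : {set T} -> nat) : Prop :=
  forall e, e \in edges G -> 1 <= c e <= k.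

Definition path_edges (u : T) (p : seq T) : seq {set T} :=
  pairmap (fun x y => [set x; y]) u p.

(* As in the path library, the vertices of the path are u :: p. *)
Definition rainbow_path G (c : {set T} -> nat) (u v : T) (p : seq T) : Prop :=
  [/\ path G u p, last u p = v, uniq (u :: p)
    & uniq (map c (path_edges u p))].

Definition rainbow_connected G (c : {set T} -> nat) : Prop :=
  forall u v : T, exists p, rainbow_path G c u v p.

Definition rainbow_colorable G (k : nat) : Prop :=
  exists c, edge_coloring G k c /\ rainbow_connected G c.

(* rc(G) = k; a relation, since rc(G) exists only for connected G. *)
Definition is_rc G (k : nat) : Prop :=
  rainbow_colorable G k /\ forall j, rainbow_colorable G j -> k <= j.

End Graphs.

(* Main.v *)
Require Import Defs.
From mathcomp Require Import all_boot.
From mathcomp Require Import zify.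

(* Two colours admit only rainbow paths of length at most two.  Hence in the
   4-coloured complete graph formed by G and its complement, every edge xy of
   one graph has a common neighbour w in the other one such that xw and yw are
   coloured differently; this condition is invariant under exchanging the two
   graphs and under renaming the colours of either.  It forces all degrees in
   both graphs to be at least 2, so that on at most 7 vertices some vertex has
   degree exactly 2 in one of the graphs: otherwise both would be 3-regular
   on 7 vertices, against the handshake lemma.  Around such a vertex the
   condition places eight edges among five vertices in one graph or the other,
   and an exhaustive search that always branches on the most constrained pair
   of vertices, run by computation, shows that this configuration cannot be
   completed. *)

Set Implicit Arguments.
Unset Strict Implicit.
Unset Printing Implicit Defensive.

(** * Exhaustive search on partial colourings *)

(* Partial 4-colourings of a complete graph on an initial segment of nat, as
   symmetric matrices: [Some (a, b)] is an edge of G if [a], of the complement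
   otherwise, and [b] is its colour there; [None] is undecided. *)
Definition pcolouring := seq (seq (option (bool * bool))).

Definition cell (M : pcolouring) i j := nth None (nth [::] M i) j.

Definition set_half (M : pcolouring) i j c : pcolouring :=
  set_nth [::] M i (set_nth None (nth [::] M i) j (Some c)).

Definition set_cell M i j c := set_half (set_half M i j c) j i c.

Definition fits (o : option (bool * bool)) (a b : bool) :=
  if o is Some (a', b') then eqb a a' && eqb b b' else true.

(** A decided pair branches over the ways to serve it; [k] equal to [i] or [j] is rejected by
    [fits], because the pair itself lies on side [a]. *)
Definition extensions n M i j : seq pcolouring :=
  match cell M i j with
  | None =>
      [seq set_cell M i j (a, b) | a <- [:: true; false], b <- [:: true; false]]
  | Some (a, _) =>
      flatten [seq [seq set_cell (set_cell M i k (~~ a, b)) j k (~~ a, ~~ b)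
                   | b <- [:: true; false]
                   & fits (cell M i k) (~~ a) b && fits (cell M j k) (~~ a) (~~ b)]
              | k <- iota 0 n]
  end.

(* The number of admissible choices (third vertex and colour) that serve the pair
   with rows [r] and [s], or a large value if the pair is already served.  The
   weights only steer the search; its soundness does not depend on them. *)
Fixpoint weight a (r s : seq (option (bool * bool))) acc :=
  match r, s with
  | o :: r', o' :: s' =>
      let t := fits o (~~ a) true && fits o' (~~ a) false in
      let f := fits o (~~ a) false && fits o' (~~ a) true in
      if (t || f) && isSome o && isSome o' then 20
      else weight a r' s' (t + (f + acc))
  | _, _ => acc
  end.

(** The value 10 postpones undecided pairs until every unserved decided pair has at least ten
    choices. *)
Definition cell_weight M i j :=
  if cell M i j is Some (a, _) then weight a (nth [::] M i) (nth [::] M j) 0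
  else 10.

Definition select n M : nat * nat :=
  (foldr (fun ij best => let w := cell_weight M ij.1 ij.2 in
            if w < best.2 then (ij, w) else best)
     ((0, 1), 100) [seq (i, j) | j <- iota 0 n, i <- iota 0 j]).1.

(** Testing the bounds of the selected pair keeps soundness independent of [select]; exhausted fuel
    never counts as a refutation. *)
Fixpoint refute n fuel M :=
  if fuel is fuel'.+1 then
    let ij := select n M in
    [&& ij.1 < ij.2, ij.2 < n & all (refute n fuel') (extensions n M ij.1 ij.2)]
  else false.

(* Vertex 0 has degree 2, with neighbours 1 and 2; vertex 3 serves the pair 01, and
   then only 2 can serve 03; vertex 4 serves 02, and then only 1 can serve 04.
   Renaming colours makes 01 and 03 have colour [false]. *)
Definition initial_facts b2 b4 b5 b6 : seq (nat * nat * (bool * bool)) :=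
  [:: (0, 1, (true, false)); (0, 2, (true, b2)); (0, 3, (false, false));
      (1, 3, (false, true)); (2, 3, (true, ~~ b2)); (0, 4, (false, b4));
      (2, 4, (false, ~~ b4)); (1, 4, (true, true));
      (0, 5, (false, b5)); (0, 6, (false, b6))].

Definition initial n b2 b4 b5 b6 :=
  foldr (fun t M => set_cell M t.1.1 t.1.2 t.2) (nseq n (nseq n None))
    [seq t <- initial_facts b2 b4 b5 b6 | t.1.2 < n].

Definition all_bool P := P true && P false.

(** The fuel 21 is the number of pairs on seven vertices: each step on an unserved pair decides a
    new one. *)
Definition refuted n :=
  all_bool (fun b2 => all_bool (fun b4 => all_bool (fun b5 => all_bool (fun b6 =>
    refute n 21 (initial n b2 b4 b5 b6))))).

(** * Soundness of the search *)

Definition agrees (M : pcolouring) (g : nat -> nat -> bool * bool) :=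
  forall i j c, cell M i j = Some c -> g i j = c.

Lemma cell_set_half M i j c k l :
  cell (set_half M i j c) k l = if (k == i) && (l == j) then Some c else cell M k l.
Proof.
rewrite /cell /set_half nth_set_nth /=; case: (k =P i) => [->|] //=.
by rewrite nth_set_nth.
Qed.

Lemma agrees_set M g i j c : (forall k l, g k l = g l k) ->
  agrees M g -> g i j = c -> agrees (set_cell M i j c) g.
Proof.
move=> gC Mg gij k l d; rewrite /set_cell !cell_set_half.
case: ifP => [/andP[/eqP-> /eqP->] [<-]|_]; first by rewrite gC.
by case: ifP => [/andP[/eqP-> /eqP->] [<-]|_ /Mg].
Qed.

Lemma agrees_fits M g i j a b : agrees M g -> g i j = (a, b) -> fits (cell M i j) a b.
Proof.
move=> Mg gij; case E: (cell M i j) => [[a' b']|] //=.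
by have := Mg _ _ _ E; rewrite gij => -[-> ->]; case: (a') (b') => [] [].
Qed.

Lemma extensions_complete n M g i j : (forall k l, g k l = g l k) ->
    (exists k b, [/\ k < n, g i k = (~~ (g i j).1, b) & g j k = (~~ (g i j).1, ~~ b)]) ->
  agrees M g -> exists2 M', M' \in extensions n M i j & agrees M' g.
Proof.
move=> gC [k [b [kn gik gjk]]] Mg; rewrite /extensions.
case E: (cell M i j) => [[a d]|].
  have gij := Mg _ _ _ E; rewrite gij /= in gik gjk.
  exists (set_cell (set_cell M i k (~~ a, b)) j k (~~ a, ~~ b)); last first.
    by apply: agrees_set => //; apply: agrees_set.
  apply/flattenP; eexists; first by apply: map_f; rewrite mem_iota; exact: kn.
  apply/mapP; exists b => //; rewrite mem_filter (agrees_fits Mg gik) (agrees_fits Mg gjk).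
  by case: (b).
case gij: (g i j) => [a d].
exists (set_cell M i j (a, d)); last exact: agrees_set.
by apply/allpairsP; exists (a, d); case: (a) (d) => [] [].
Qed.

(** A colouring that serves every pair survives in some branch at each step, whereas here all
    branches die. *)
Lemma refute_sound n fuel M g : (forall k l, g k l = g l k) ->
    (forall i j, i < n -> j < n -> i != j ->
       exists k b, [/\ k < n, g i k = (~~ (g i j).1, b) & g j k = (~~ (g i j).1, ~~ b)]) ->
  refute n fuel M -> ~ agrees M g.
Proof.
move=> gC gP; elim: fuel M => [|fuel IH] M //=.
move=> /and3P[ltij ltjn /allP refM] Mg.
have wit := gP _ _ (ltn_trans ltij ltjn) ltjn (negbT (ltn_eqF ltij)).
have [M' M'ext M'g] := extensions_complete gC wit Mg.
exact: IH (refM _ M'ext) M'g.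
Qed.

Lemma all_boolE P : all_bool P -> forall b, P b.
Proof. by case/andP => ? ? []. Qed.

Lemma refuted_sound n : refuted n ->
  forall g b2 b4 b5 b6, (forall k l, g k l = g l k) ->
    (forall i j, i < n -> j < n -> i != j ->
       exists k b, [/\ k < n, g i k = (~~ (g i j).1, b) & g j k = (~~ (g i j).1, ~~ b)]) ->
  ~ {in initial_facts b2 b4 b5 b6, forall t, t.1.2 < n -> g t.1.1 t.1.2 = t.2}.
Proof.
move=> ref g b2 b4 b5 b6 gC gP facts.
move: ref => /all_boolE/(_ b2)/all_boolE/(_ b4)/all_boolE/(_ b5)/all_boolE/(_ b6).
move/(refute_sound gC gP); apply; rewrite /initial.
elim: (initial_facts _ _ _ _) facts => [_|t s IH facts] /=.
  by move=> i j c; rewrite /cell nth_nseq; case: ifP; rewrite ?nth_nseq ?nth_nil //; case: ifP.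
have {}IH : agrees (foldr (fun t M => set_cell M t.1.1 t.1.2 t.2) (nseq n (nseq n None))
    [seq t <- s | t.1.2 < n]) g.
  by apply: IH => u us; apply: facts; rewrite inE us orbT.
case: ifP => //= tn; apply: agrees_set => //.
by apply: facts; rewrite ?mem_head.
Qed.

Lemma refuted_5_7 n : 4 < n <= 7 -> refuted n.
Proof.
move=> n57; have /or3P[] : [|| n == 5, n == 6 | n == 7] by lia.
all: by move/eqP->; vm_compute.
Qed.

(** * Degrees in doubly rainbow colourings *)

(* [f x y] holds the graph containing the edge xy (G if [true]) and its colour there;
   the diagonal of [f] is irrelevant. *)
Definition doubly_rainbow (T : finType) (f : T -> T -> bool * bool) : Prop :=
  (forall x y, f x y = f y x) /\
  (forall x y, x != y -> exists w b,
     f x w = (~~ (f x y).1, b) /\ f y w = (~~ (f x y).1, ~~ b)).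

Definition nbrs (T : finType) (f : T -> T -> bool * bool) v :=
  [set w | (w != v) && (f v w).1].

Definition swap_sides (T : finType) (f : T -> T -> bool * bool) :=
  fun x y => (~~ (f x y).1, (f x y).2).

Definition recolour (T : finType) (s t : bool) (f : T -> T -> bool * bool) :=
  fun x y => ((f x y).1, (if (f x y).1 then s else t) (+) (f x y).2).

Section DoublyRainbow.
Variable T : finType.
Implicit Type f : T -> T -> bool * bool.

Lemma swap_sides_doubly_rainbow f : doubly_rainbow f -> doubly_rainbow (swap_sides f).
Proof.
move=> [fC fP]; split=> [x y|x y /fP[w [b [e1 e2]]]]; first by rewrite /swap_sides fC.
by exists w, b; rewrite /swap_sides e1 e2.
Qed.

Lemma recolour_doubly_rainbow s t f : doubly_rainbow f -> doubly_rainbow (recolour s t f).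
Proof.
move=> [fC fP]; split=> [x y|x y /fP[w [b [e1 e2]]]]; first by rewrite /recolour fC.
exists w, ((if ~~ (f x y).1 then s else t) (+) b).
by rewrite /recolour e1 e2 /= addbN.
Qed.

Lemma card_nbrs_swap f v : #|nbrs f v| + #|nbrs (swap_sides f) v| = #|T|.-1.
Proof.
rewrite -(cardsC1 v) -(cardsID (nbrs f v) [set~ v]); congr (_ + _); apply: eq_card => w.
  by rewrite !inE andbA andbb.
by rewrite !inE /swap_sides; case: (w == v) => //=; rewrite andbT.
Qed.

(** The sides alternate: [x] serves [vp] in the complement, then [q] serves [vx] in G; [q] is not
    [p] because [px] lies in the complement. *)
Lemma second_nbr f v p : doubly_rainbow f -> p != v -> (f v p).1 ->
  exists x q b c, [/\ x != v, q != v & q != p] /\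
    [/\ f v x = (false, b), f p x = (false, ~~ b), f v q = (true, c) & f x q = (true, ~~ c)].
Proof.
move=> [fC fP] pv fvp.
have [|x [b []]] := fP v p; first by rewrite eq_sym.
rewrite fvp /= => fvx fpx.
have xv : x != v by apply/eqP => xv; move: fvp; rewrite fC -xv fpx.
have [|q [c []]] := fP v x; first by rewrite eq_sym.
rewrite fvx /= => fvq fxq.
exists x, q, b, c; split=> //; split=> //; apply/eqP => qE.
  by move: fxq; rewrite qE fC fvx.
by move: fxq; rewrite qE fC fpx.
Qed.

Lemma card_nbrs_ge2 f v : doubly_rainbow f -> 1 < #|T| -> 1 < #|nbrs f v|.
Proof.
move=> fD; have [fC fP] := fD => cT.
have [p pv fvp] : exists2 p, p != v & (f v p).1.
  have [u uv] : exists u, u != v.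
    have : 0 < #|[set~ v]| by rewrite cardsC1; case: #|T| cT.
    by case/card_gt0P => u; rewrite !inE => uv; exists u.
  have [fvu|/negbTE fvu] := boolP (f v u).1; first by exists u.
  (* If [vu] is not an edge of G, the vertex serving it is a neighbour of [v]. *)
  have [|p [b []]] := fP v u; first by rewrite eq_sym.
  rewrite fvu /= => fvp fup.
  exists p; last by rewrite fvp.
  by apply/eqP => pE; move: fvu; rewrite fC -pE fup.
have [x [q [b [c [[xv qv qp] [_ _ fvq _]]]]]] := second_nbr fD pv fvp.
rewrite (leq_trans _ (subset_leq_card (_ : [set p; q] \subset _))) //.
  by rewrite cards2 eq_sym qp.
by apply/subsetP => w; rewrite !inE => /orP[] /eqP->; rewrite ?pv ?qv ?fvp ?fvq.
Qed.

Lemma sum_card_nbrs_even f : doubly_rainbow f -> ~~ odd (\sum_v #|nbrs f v|).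
Proof.
move=> [fC _].
(* A linear order on T splits the pairs of adjacent vertices into two halves. *)
pose lower v := #|[set w in nbrs f v | enum_rank w < enum_rank v]|.
suff -> : \sum_v #|nbrs f v| = \sum_v lower v + \sum_v lower v by rewrite addnn odd_double.
have -> : \sum_v #|nbrs f v|
    = \sum_v lower v + \sum_v #|[set w in nbrs f v | enum_rank v < enum_rank w]|.
  rewrite -big_split; apply: eq_bigr => v _.
  rewrite -(cardsID [set w | enum_rank w < enum_rank v] (nbrs f v)) /lower.
  congr (_ + _); apply: eq_card => w; rewrite !inE //.
  case: eqP => [->|/eqP wv] //=; first by rewrite andbF.
  rewrite -leqNgt andbC; case: (f v w).1 => //=.
  by rewrite leq_eqVlt (inj_eq val_inj) (inj_eq enum_rank_inj) eq_sym (negbTE wv).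
have card_sum (A : {set T}) : #|A| = \sum_w (w \in A : nat).
  by rewrite -sum1_card big_mkcond; apply: eq_bigr => w _; case: ifP.
congr (_ + _); rewrite /lower.
under eq_bigr do rewrite card_sum.
rewrite exchange_big; apply: eq_bigr => v _ /=.
by rewrite card_sum; apply: eq_bigr => w _; rewrite !inE eq_sym fC.
Qed.

Lemma no_card_nbrs_eq2 f v : doubly_rainbow f -> #|T| <= 7 -> #|nbrs f v| <> 2.
Proof.
move=> fD cT /eqP/cards2P[p [q [pq nE]]].
have mem_n w : (w != v) && (f v w).1 = (w == p) || (w == q).
  by have := erefl (w \in nbrs f v); rewrite {2}nE !inE.
have pv : p != v by have := mem_n p; rewrite eqxx => /andP[].
have fvp : (f v p).1 by have := mem_n p; rewrite eqxx => /andP[].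
have qv : q != v by have := mem_n q; rewrite eqxx orbT => /andP[].
have fvq : (f v q).1 by have := mem_n q; rewrite eqxx orbT => /andP[].
(* As [v] has only the neighbours [p] and [q], the second neighbour obtained from either one is the
   other. *)
have [x [q' [b [c [[xv qv' qp'] [fvx fpx fvq' fxq]]]]]] := second_nbr fD pv fvp.
have {qv' qp'} q'E : q' = q.
  by have := mem_n q'; rewrite qv' fvq' (negbTE qp') => /esym/eqP.
have [y [p' [b' [c' [[yv pv' pq'] [fvy fqy fvp' fyp]]]]]] := second_nbr fD qv fvq.
have {pv' pq'} p'E : p' = p.
  by have := mem_n p'; rewrite pv' fvp' (negbTE pq') orbF => /esym/eqP.
subst p' q'; have [fC _] := fD.
have xp : x != p by apply: contraL fvp => /eqP<-; rewrite fvx.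
have xq : x != q by apply: contraL fvq => /eqP<-; rewrite fvx.
have yp : y != p by apply: contraL fvp => /eqP<-; rewrite fvy.
have yq : y != q by apply: contraL fvq => /eqP<-; rewrite fvy.
have xy : x != y by apply/eqP => xyE; move: fyp; rewrite -xyE fC fpx.
(* Shifting by the colours [c'] of [vp] and [b] of [vx] makes both [false]. *)
set h := recolour c' b f; have [hC hP] : doubly_rainbow h by exact: recolour_doubly_rainbow.
(* This order matches the vertex numbers 0 to 4 of [initial_facts]. *)
pose s0 := [:: v; p; q; x; y].
pose s := s0 ++ [seq z <- enum T | z \notin s0].
have s_mem z : z \in s by rewrite mem_cat mem_filter mem_enum andbT orbN.
have s0_uniq : uniq s0.
  by rewrite /= !inE !negb_or pq xy !(eq_sym v) pv qv xv yv !(eq_sym p) xp yp !(eq_sym q) xq yq.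
have s_uniq : uniq s.
  rewrite cat_uniq s0_uniq filter_uniq ?enum_uniq // andbT.
  by apply/hasPn => z; rewrite mem_filter => /andP[].
have s_size : size s = #|T|.
  by rewrite cardE; apply/perm_size/uniq_perm; rewrite ?enum_uniq // => z; rewrite s_mem mem_enum.
have s_out i : 2 < i < #|T| -> (h v (nth v s i)).1 = false.
  move=> /andP[i2 iT].
  have nth_neq j : j < i -> nth v s i != nth v s j.
    by move=> ji; rewrite nth_uniq ?s_size ?(ltn_trans ji) // neq_ltn ji orbT.
  have iv : nth v s i != v by apply: (nth_neq 0); rewrite ?(ltn_trans _ i2).
  have ip : nth v s i != p by apply: (nth_neq 1); rewrite ?(ltn_trans _ i2).
  have iq : nth v s i != q by apply: (nth_neq 2).
  by have := mem_n (nth v s i); rewrite iv (negbTE ip) (negbTE iq).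
have ref : refuted #|T|.
  by apply: refuted_5_7; rewrite cT andbT -s_size size_cat.
pose g i j := h (nth v s i) (nth v s j).
apply: (refuted_sound ref (g := g) (b2 := c' (+) c) (b4 := b (+) b')
          (b5 := (g 0 5).2) (b6 := (g 0 6).2)).
- by move=> k l; apply: hC.
- move=> i j iT jT ij.
  have [|w [d [hiw hjw]]] := hP (nth v s i) (nth v s j); first by rewrite nth_uniq ?s_size.
  by exists (index w s), d; rewrite /g nth_index // -s_size index_mem s_mem.
have out i : 2 < i -> i < #|T| -> g 0 i = (false, (g 0 i).2).
  by move=> i2 iT; rewrite [LHS]surjective_pairing s_out ?i2.
have hE z w d : f z w = d -> h z w = (d.1, (if d.1 then c' else b) (+) d.2) by rewrite /h /recolour => ->.
have g01 : g 0 1 = (true, false) by rewrite [LHS](hE _ _ _ fvp') addbb.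
have g02 : g 0 2 = (true, c' (+) c) by exact: hE fvq'.
have g03 : g 0 3 = (false, false) by rewrite [LHS](hE _ _ _ fvx) addbb.
have g13 : g 1 3 = (false, true) by rewrite [LHS](hE _ _ _ fpx) addbN addbb.
have g23 : g 2 3 = (true, ~~ (c' (+) c)).
  by rewrite -addbN; apply: (hE q x (true, ~~ c)); rewrite fC.
have g04 : g 0 4 = (false, b (+) b') by exact: hE fvy.
have g24 : g 2 4 = (false, ~~ (b (+) b')) by rewrite -addbN; apply: hE fqy.
have g14 : g 1 4 = (true, true).
  by rewrite [LHS](hE p y (true, ~~ c')) ?[f p y]fC //= addbN addbb.
move=> t; rewrite !inE.
do 8 (case/orP=> [/eqP-> _ //|]).
by case/orP => /eqP->; [apply: (out 5) | apply: (out 6)].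
Qed.
End DoublyRainbow.

Lemma doubly_rainbow_large (T : finType) (f : T -> T -> bool * bool) :
  doubly_rainbow f -> 1 < #|T| -> 7 < #|T|.
Proof.
move=> fD T1; rewrite ltnNge; apply/negP => T7.
have fD' := swap_sides_doubly_rainbow fD.
(* The two degrees of [v] are at least 3 and sum to at most 6. *)
have deg3 v : #|nbrs f v| = 3 /\ #|T| = 7.
  have := card_nbrs_swap f v.
  have := card_nbrs_ge2 v fD T1; have := card_nbrs_ge2 v fD' T1.
  have := @no_card_nbrs_eq2 _ f v fD T7; have := @no_card_nbrs_eq2 _ _ v fD' T7.
  by lia.
have [v _] : exists v : T, true by have /card_gt0P[v] := ltnW T1; exists v.
have := sum_card_nbrs_even fD; rewrite (eq_bigr (fun=> 3)) => [|u _]; last by have [] := deg3 u.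
by rewrite sum_nat_const; have [_ ->] := deg3 v.
Qed.

(** * From rainbow connection to doubly rainbow colourings *)

Lemma rainbow_path2 (T : finType) (G : sgraph T) c u v :
    edge_coloring G 2 c -> rainbow_connected G c -> u != v -> ~~ G u v ->
  exists w, [/\ G u w, G v w & (c [set v; w] == 1) = ~~ (c [set u; w] == 1)].
Proof.
move=> cG rG uv Guv; have [p [Gp lp up cp]] := rG u v.
have c12 x y : G x y -> c [set x; y] = 1 \/ c [set x; y] = 2.
  move=> Gxy; have /cG : [set x; y] \in edges G by apply/imsetP; exists (x, y); rewrite ?inE.
  by lia.
(* Fewer than two edges would force [u = v] or adjacency; three edges cannot get distinct colours
   out of two. *)
case: p Gp lp cp {up} => [|a [|a' [|a'' p]]] /=.
- by move=> _ uE; rewrite uE eqxx in uv.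
- by move=> /andP[Gua _] aE; rewrite -aE Gua in Guv.
- move=> /and3P[Gua Gav _] <-; rewrite inE andbT => cc.
  exists a; split=> //; first by rewrite adj_sym.
  rewrite [[set a'; a]]setUC; move: cc.
  by case: (c12 _ _ Gua) (c12 _ _ Gav) => -> [] ->.
move=> /and4P[/c12 c1 /c12 c2 /c12 c3 _] _.
rewrite !inE !negb_or => /and3P[/and3P[]].
by case: c1 c2 c3 => -> [] -> [] ->.
Qed.

Theorem theorem2 (n : nat) (hn : 4 <= n <= 7) :
  ~ exists (T : finType) (G : sgraph T),
      [/\ #|T| = n,
          graph_connected G,
          graph_connected (compl G),
          is_rc G 2
        & is_rc (compl G) 2].
Proof.
move=> [T [G [cT _ _ [[c1 [c1G r1]] _] [[c2 [c2G r2]] _]]]].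
pose f u v := (G u v, (if G u v then c1 else c2) [set u; v] == 1).
have fD : doubly_rainbow f; last by have := doubly_rainbow_large fD; lia.
split=> [x y|x y xy]; first by rewrite /f adj_sym setUC.
have [Gxy|/negbTE nGxy] := boolP (G x y).
  (* An edge of one graph is a non-edge of the other, whose rainbow path supplies the vertex serving
     it. *)
  have nG' : ~~ compl G x y by rewrite /= /compl_adj Gxy andbF.
  have [w [/andP[_ /negbTE xw] /andP[_ /negbTE yw] cc]] := rainbow_path2 c2G r2 xy nG'.
  by exists w, (c2 [set x; w] == 1); rewrite /f Gxy xw yw cc.
have [w [xw yw cc]] := rainbow_path2 c1G r1 xy (negbT nGxy).
by exists w, (c1 [set x; w] == 1); rewrite /f nGxy xw yw cc.
Qed.
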